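(* Let $G$ be a Hausdorff topological group which is FSIN and of finite exponent. Then $G$ is SIN.
   Context: Let $e$ be the unit of $G$ and $\mathcal N(e)$ the set of all neighborhoods of $e$ in $G$. The left uniformity $\mathcal U_l$ of $G$ has as a basis of entourages the sets $\{(x,y)\in G\times G: x^{-1}y\in V\}$, $V\in\mathcal N(e)$; the right uniformity $\mathcal U_r$ has as a basis of entourages the sets $\{(x,y)\in G\times G: xy^{-1}\in V\}$, $V\in\mathcal N(e)$. $G$ is SIN if $\mathcal U_l=\mathcal U_r$. A function $f:G\to\mathbb R$ is left (right) uniformly continuous if it is uniformly continuous when $G$ is equipped with $\mathcal U_l$ (with $\mathcal U_r$) and $\mathbb R$ with its usual metric. $G$ is FSIN if every bounded left uniformly continuous function $f:G\to\mathbb R$ is right uniformly continuous. $G$ is of finite exponent if there is an integer $p\ge 1$ such that $x^p=e$ for all $x\in G$. *)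

(* Defs.v *)
From HB Require Import structures.
From mathcomp Require Import all_boot all_order all_algebra.
From mathcomp Require Import all_classical all_reals.
From mathcomp Require Import topology normedtype.
Import numFieldNormedType.Exports.

Set Implicit Arguments.
Unset Strict Implicit.
Unset Printing Implicit Defensive.

Local Open Scope classical_set_scope.
Local Open Scope group_scope.

HB.mixin Record Topological_isTopologicalGroup G & Topological G & Group G := {
  mulg_continuous : continuous (fun xy : G * G => xy.1 * xy.2);
  invg_continuous : continuous (fun x : G => x^-1)
}.

#[short(type="topologicalGroupType")]
HB.structure Definition TopologicalGroup :=
  {G of Topological G & Group G & Topological_isTopologicalGroup G}.

Definition left_uniformity (G : topologicalGroupType) : set_system (G * G) :=
  filter_from (nbhs (1 : G)) (fun V => [set xy | V (xy.1^-1 * xy.2)]).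

Definition right_uniformity (G : topologicalGroupType) : set_system (G * G) :=
  filter_from (nbhs (1 : G)) (fun V => [set xy | V (xy.1 * xy.2^-1)]).

Arguments left_uniformity G : clear implicits.
Arguments right_uniformity G : clear implicits.

(* Aliases of the carrier: G itself has no canonical uniform structure. *)
Definition left_uniform (G : Type) : Type := G.
Definition right_uniform (G : Type) : Type := G.

HB.instance Definition _ (G : topologicalGroupType) :=
  TopologicalGroup.copy (left_uniform G) G.
HB.instance Definition _ (G : topologicalGroupType) :=
  TopologicalGroup.copy (right_uniform G) G.

Section UniformAxioms.
Variable G : topologicalGroupType.

Lemma nbhs1_inv (V : set G) : nbhs (1 : G) V -> nbhs (1 : G) [set x | V x^-1].
Proof. by move=> nV; apply: (@invg_continuous G 1); rewrite /= invg1. Qed.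

Lemma nbhs1_split (V : set G) : nbhs (1 : G) V ->
  exists2 W, nbhs (1 : G) W & forall x y, W x -> W y -> V (x * y).
Proof.
move=> nV; have := @mulg_continuous G (1, 1) V.
rewrite /= mulg1 => /(_ nV)[[A B] /= [nA nB] AB].
exists (A `&` B); first exact: filterI.
by move=> x y [Ax _] [_ By]; apply: (AB (x, y)).
Qed.

Lemma mull_continuous (a : G) : continuous (fun x : G => a * x).
Proof.
move=> x V nV; have [[A B] /= [nA nB] AB] := @mulg_continuous G (a, x) V nV.
by apply: filterS nB => y By; apply: (AB (a, y)); split=> //=; exact: nbhs_singleton.
Qed.

Lemma mulr_continuous (a : G) : continuous (fun x : G => x * a).
Proof.
move=> x V nV; have [[A B] /= [nA nB] AB] := @mulg_continuous G (x, a) V nV.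
by apply: filterS nA => y Ay; apply: (AB (y, a)); split=> //=; exact: nbhs_singleton.
Qed.

Lemma left_uniformity_filter : Filter (left_uniformity G).
Proof.
apply: filter_from_filter; first by exists setT; exact: filterT.
by move=> U V nU nV; exists (U `&` V); first exact: filterI.
Qed.

Lemma right_uniformity_filter : Filter (right_uniformity G).
Proof.
apply: filter_from_filter; first by exists setT; exact: filterT.
by move=> U V nU nV; exists (U `&` V); first exact: filterI.
Qed.

Local Open Scope relation_scope.

Lemma left_uniformity_diagonal (A : set (G * G)) :
  left_uniformity G A -> diagonal `<=` A.
Proof.
move=> [V nV VA] [x y]; rewrite /diagonal /= => ->; apply: VA => /=.
by rewrite mulVg; exact: nbhs_singleton.
Qed.

Lemma right_uniformity_diagonal (A : set (G * G)) :
  right_uniformity G A -> diagonal `<=` A.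
Proof.
move=> [V nV VA] [x y]; rewrite /diagonal /= => ->; apply: VA => /=.
by rewrite mulgV; exact: nbhs_singleton.
Qed.

Lemma left_uniformity_inv (A : set (G * G)) :
  left_uniformity G A -> left_uniformity G A^-1.
Proof.
move=> [V nV VA]; exists [set x | V x^-1]%g; first exact: nbhs1_inv.
by move=> [x y] /=; rewrite invgM invgK => Vxy; apply: VA.
Qed.

Lemma right_uniformity_inv (A : set (G * G)) :
  right_uniformity G A -> right_uniformity G A^-1.
Proof.
move=> [V nV VA]; exists [set x | V x^-1]%g; first exact: nbhs1_inv.
by move=> [x y] /=; rewrite invgM invgK => Vxy; apply: VA.
Qed.

Lemma left_uniformity_split (A : set (G * G)) : left_uniformity G A ->
  exists2 B, left_uniformity G B & B \; B `<=` A.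
Proof.
move=> [V nV VA]; have [W nW WV] := nbhs1_split nV.
exists [set xy | W (xy.1^-1 * xy.2)%g]; first by exists W.
move=> [x y] /= [z /= Wxz Wzy]; apply: VA => /=.
by rewrite -(mulVKg z y) mulgA; exact: WV.
Qed.

Lemma right_uniformity_split (A : set (G * G)) : right_uniformity G A ->
  exists2 B, right_uniformity G B & B \; B `<=` A.
Proof.
move=> [V nV VA]; have [W nW WV] := nbhs1_split nV.
exists [set xy | W (xy.1 * xy.2^-1)%g]; first by exists W.
move=> [x y] /= [z /= Wxz Wzy]; apply: VA => /=.
by rewrite -(mulgVK z x) -mulgA; exact: WV.
Qed.

Lemma nbhs_left_uniformity : @nbhs G G = nbhs_ (left_uniformity G).
Proof.
apply/funext => x; apply/seteqP; split => A.
- move=> nA; exists [set yz | A (x * (yz.1^-1 * yz.2))%g].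
    exists [set z | A (x * z)%g] => //.
    by apply: (@mull_continuous x 1); rewrite mulg1.
  by move=> y /xsectionP /=; rewrite mulVKg.
- move=> [B [V nV VB] BA].
  have : nbhs x [set y | V (x^-1 * y)%g].
    by apply: (@mull_continuous x^-1%g x); rewrite mulVg.
  by apply: filterS => y Vy; apply/BA/xsectionP/VB.
Qed.

Lemma nbhs_right_uniformity : @nbhs G G = nbhs_ (right_uniformity G).
Proof.
apply/funext => x; apply/seteqP; split => A.
- move=> nA; exists [set yz | A ((yz.1 * yz.2^-1)^-1 * x)%g].
    exists [set z | A (z^-1 * x)%g] => //.
    apply: (@nbhs1_inv [set z | A (z * x)%g]).
    by apply: (@mulr_continuous x 1); rewrite mul1g.
  by move=> y /xsectionP /=; rewrite invgM invgK mulgVK.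
- move=> [B [V nV VB] BA].
  have : nbhs x [set y | V (x * y^-1)%g].
    have : nbhs (x * x^-1)%g V by rewrite mulgV.
    move=> /(@mull_continuous x x^-1%g).
    exact: (@invg_continuous G x).
  by apply: filterS => y Vy; apply/BA/xsectionP/VB.
Qed.

End UniformAxioms.

HB.instance Definition _ (G : topologicalGroupType) :=
  @Nbhs_isUniform_mixin.Build (left_uniform G) (left_uniformity G)
    (left_uniformity_filter G) (@left_uniformity_diagonal G)
    (@left_uniformity_inv G) (@left_uniformity_split G)
    (nbhs_left_uniformity G).

HB.instance Definition _ (G : topologicalGroupType) :=
  @Nbhs_isUniform_mixin.Build (right_uniform G) (right_uniformity G)
    (right_uniformity_filter G) (@right_uniformity_diagonal G)
    (@right_uniformity_inv G) (@right_uniformity_split G)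
    (nbhs_right_uniformity G).

Definition left_unif_continuous (R : realType) (G : topologicalGroupType)
  (f : G -> R) := unif_continuous (f : left_uniform G -> R).

Definition right_unif_continuous (R : realType) (G : topologicalGroupType)
  (f : G -> R) := unif_continuous (f : right_uniform G -> R).

Definition SIN (G : topologicalGroupType) : Prop :=
  left_uniformity G = right_uniformity G.

Definition FSIN (R : realType) (G : topologicalGroupType) : Prop :=
  forall f : G -> R, bounded_fun f ->
    left_unif_continuous f -> right_unif_continuous f.

Definition finite_exponent (G : groupType) : Prop :=
  exists2 p : nat, (1 <= p)%N & forall x : G, x ^+ p = 1.

(* Main.v *)
Require Import Defs.
From mathcomp Require Import all_boot all_order all_algebra.
From mathcomp Require Import all_classical all_reals.
From mathcomp Require Import topology normedtype.
From mathcomp Require Import wochoice ereal.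

(* Call [A] neutral if every [A V] contains some [U A]. Separating [A] from the
   complement of [A V] by a bounded left uniformly continuous function shows
   that in an FSIN group every set is neutral. If [G] is not SIN, choose a
   well-ordered index set [D] of minimal length carrying a family [t] that is
   not equiconj, i.e. conjugation of small elements by the [t i] is not uniformly
   small; shorter families are then equiconj.
   - Transfinite choice gives, in every neighborhood of 1, a left separated
     family [l] indexed by [D].
   - An equiconj left separated family [l] is separated on both sides, and then
     it can label relations: neutrality of the set of all [g * l i] with
     [(g, i)] in a relation makes the relation invariant under small elements.
     Labelling [t] by a two-sided separated [D]-family would make [t] equiconj,
     so some neighborhood [V1] contains no such family and is covered by double
     cosets [M * h a * M], where [a] runs over a proper initial segment of [D].
   - If [u] is small and [g^-1 * u * g] lies in such a double coset, a relation
     labelled by that segment records how a linear order compares discretized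
     versions of [g] and [u * g]. The powers of [u] preserve it, and [u ^+ p = 1]
     forbids a nontrivial monotone cycle, so [g^-1 * u * g] is small.
   Hence the [D]-family [l] near 1 given by the first step is equiconj, so
   two-sided separated, contradicting the choice of [V1]. *)

Set Implicit Arguments.
Unset Strict Implicit.
Unset Printing Implicit Defensive.

Import Order.TTheory GRing.Theory Num.Theory.
Import numFieldNormedType.Exports.

Local Open Scope classical_set_scope.

(** * Separating a set by a bounded uniformly continuous function *)

Section Urysohn.
Local Open Scope ring_scope.

(** The function is the distance to [A] for the gauge pseudometric of [E]; it is 1-Lipschitz, and
    bounded because gauge distances never exceed 2. *)
Lemma unif_continuous_separation (R : realType) (T : uniformType)
    (A : set T) (E : set (T * T)) : entourage E -> A !=set0 ->
  exists f : T -> R, [/\ bounded_fun f, unif_continuous f,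
    forall a, A a -> f a = 0 &
    exists2 e, 0 < e & forall x, f x < e -> exists2 a, A a & E (a, x)].
Proof.
move=> entE [a0 Aa0].
pose T' : pseudoMetricType R := gauge.type entE.
pose d := @edist_inf R T' A.
have d2 x y : (@edist R T' (x, y) <= 2%:E)%E.
  by apply: edist_fin => //=; exact: countable_uniform.countable_uniform_bounded.
have dle2 x : (d x <= 2%:E)%E.
  by apply: le_trans (d2 x a0); apply: ereal_inf_lbound; exists a0.
have dfin x : d x \is a fin_num.
  by rewrite ge0_fin_numE ?edist_inf_ge0// (le_lt_trans (dle2 x)) ?ltry.
have efin (x y : T') : edist (x, y) \is a fin_num.
  by rewrite ge0_fin_numE ?edist_ge0// (le_lt_trans (d2 x y)) ?ltry.
exists (fun x => fine (d x)); split.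
- exists 2; split; first exact: num_real.
  move=> M /ltW + x _ /=; apply: le_trans.
  by rewrite ger0_norm ?fine_ge0 ?edist_inf_ge0// -lee_fin fineK.
- move=> B /=; rewrite -entourage_ballE => -[_/posnumP[e] eB].
  have /(gauge.gauge_ent entE) : @entourage T' [set xy | ball xy.1 (e%:num / 2) xy.2].
    by rewrite -entourage_ballE; exists (e%:num / 2) => //=.
  apply: (@filterS _ _ (@entourage_filter T)) => -[x y] /= bxy; apply: eB => /=.
  have exy : fine (edist (x : T', y : T')) <= e%:num / 2.
    by rewrite -lee_fin fineK//; exact: edist_fin.
  have dxy (u v : T') : fine (d u) <= fine (edist (u, v)) + fine (d v).
    by rewrite -fineD// -lee_fin !fineK ?fin_numD ?efin ?dfin//; exact: edist_inf_triangle.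
  have := dxy x y; have := dxy y x; rewrite edist_sym => h1 h2.
  rewrite /ball /= ltr_norml; apply/andP; split.
    rewrite ltrBrDr addrC ltrBlDr (le_lt_trans h1)// addrC ltrD2l.
    by rewrite (le_lt_trans exy)// ltr_pdivrMr// ltr_pMr// ltr1n.
  rewrite ltrBlDr (le_lt_trans h2)// ltrD2r.
  by rewrite (le_lt_trans exy)// ltr_pdivrMr// ltr_pMr// ltr1n.
- by move=> a Aa; rewrite /d edist_inf0.
- have : @entourage T' E by exists 0%N => // -[x y] [].
  rewrite -entourage_ballE => -[e e0 eE]; exists e => // x.
  rewrite -lte_fin fineK// => /ereal_inf_lt[_ [a Aa <-]] /edist_lt_ball /= xa.
  by exists a => //; apply: eE => /=; exact: ball_sym.
Qed.

End Urysohn.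

(** * Well-orders, transfinite choice and maximal separated sets *)

Definition strict_total_order (I : Type) (lt : I -> I -> Prop) :=
  [/\ forall x, ~ lt x x, forall x y z, lt x y -> lt y z -> lt x z &
      forall x y, x <> y -> lt x y \/ lt y x].

Lemma well_order_exists (I : eqType) : exists lt : I -> I -> Prop,
  strict_total_order lt /\ well_founded lt.
Proof.
have [R woR] := well_ordering_principle I.
have min (P : I -> Prop) : (exists x, P x) ->
    exists m, P m /\ forall y, P y -> R m y.
  move=> [x Px]; have [|m [[Pm mlb] _]] := woR [pred x | `[< P x >]].
    by exists x; rewrite inE.
  exists m; split; first by move: Pm; rewrite inE.
  by move=> y Py; apply: mlb; rewrite inE.
have tot x y : R x y \/ R y x.
  have [|m [[->|->] mlb]] := min (fun z => z = x \/ z = y).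
  - by exists x; left.
  - by left; apply: mlb; right.
  - by right; apply: mlb; left.
have anti x y : R x y -> R y x -> x = y.
  move=> xy yx; have [|m [_ mu]] := woR [pred z | (z == x) || (z == y)].
    by exists x; rewrite inE eqxx.
  have refl z : R z z by case: (tot z z).
  rewrite -(mu x) ?(mu y)//; split; rewrite ?inE ?eqxx ?orbT//.
  - by move=> z /orP[]/eqP ->.
  - by move=> z /orP[]/eqP ->.
exists (fun x y => ~ R y x); split; first split.
- by move=> x; apply; case: (tot x x).
- move=> x y z nyx nzy zx.
  have [|m [+ mlb]] := min (fun w => [\/ w = x, w = y | w = z]).
    by exists x; constructor 1.
  have mx := mlb x ltac:(by constructor 1).
  have my := mlb y ltac:(by constructor 2).
  have mz := mlb z ltac:(by constructor 3).
  case=> e; subst m => //.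
  by have e := anti _ _ mz zx; subst z.
- move=> x y xy; apply: contrapT => /not_orP[/contrapT yx /contrapT xy'].
  by apply: xy; exact: anti.
- move=> x; apply: contrapT => nx.
  have [|m [nm mlb]] := min (fun y => ~ Acc (fun x y => ~ R y x) y).
    by exists x.
  apply: nm; constructor => y nmy; apply: contrapT => /mlb.
  exact: nmy.
Qed.

(** Well-founded recursion: the values chosen below [x], completed by the default [y0], serve as the
    total function [h]. *)
Lemma transfinite_choice (I Y : Type) (lt : I -> I -> Prop) (D : set I)
    (C : I -> Y -> Prop) (Q : Y -> Y -> Prop) (y0 : Y) :
  well_founded lt ->
  (forall x, D x -> forall h : I -> Y,
    exists2 y, C x y & forall a, D a -> lt a x -> Q (h a) y) ->
  exists F : I -> Y, forall x, D x ->
    C x (F x) /\ forall a, D a -> lt a x -> Q (F a) (F x).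
Proof.
move=> wf step.
pose ext x (h : forall a, lt a x -> Y) a :=
  if pselect (lt a x) is left ax then h a ax else y0.
pose ok x (h : forall a, lt a x -> Y) y :=
  C x y /\ forall a, D a -> lt a x -> Q (ext x h a) y.
pose next x h := if pselect (exists y, ok x h y) is left e
  then projT1 (cid e) else y0.
pose F := Fix wf (fun=> Y) next.
have FE x : F x = next x (fun a _ => F a).
  apply: Fix_eq => y f g fg; congr next.
  by apply: functional_extensionality_dep => a; apply: funext => ?; exact: fg.
exists F => x Dx.
have : ok x (fun a _ => F a) (F x).
  rewrite FE /next; case: pselect => [e|[]]; first exact: projT2 (cid e).
  by have [y Cy Qy] := step x Dx (ext x (fun a _ => F a)); exists y.
move=> [CF QF]; split=> // a Da ax; have := QF a Da ax.
by rewrite /ext; case: pselect.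
Qed.

Lemma maximal_separated (I : Type) (D : set I) (e : I -> I -> Prop) :
  (forall x, e x x) -> (forall x y, e x y -> e y x) ->
  exists J : set I, [/\ J `<=` D,
    forall x y, J x -> J y -> e x y -> x = y &
    forall x, D x -> exists2 y, J y & e y x].
Proof.
move=> refl sym.
have [F FP Ftot|J [[JD Jsep] Jmax]] := @Zorn_bigcup I (fun J => J `<=` D /\
    forall x y, J x -> J y -> e x y -> x = y).
  split; first by move=> x [X /FP[XD _] /XD].
  move=> x y [X FX Xx] [Y FY Yy].
  have [XY|YX] := Ftot _ _ FX FY.
  - by apply: (FP _ FY).2 => //; exact: XY.
  - by apply: (FP _ FX).2 => //; exact: YX.
exists J; split=> // x Dx; apply: contrapT => nx.
have Jx : ~ J x by move=> Jx; apply: nx; exists x.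
apply: (Jmax (J `|` [set x])).
  split; first by move=> y Jy; left.
  by move=> JxJ; apply: Jx; apply: JxJ; right.
split; first by move=> y [/JD//|->].
move=> y z [Jy|->] [Jz|->]//; first exact: Jsep.
- by move=> yx; case: nx; exists y.
- by move=> xz; case: nx; exists z => //; exact: sym.
Qed.

Local Open Scope group_scope.

(** * Neutral sets, equiconj families and labels *)

Lemma nbhs1I (G : topologicalGroupType) (U V : set G) :
  nbhs (1 : G) U -> nbhs (1 : G) V -> nbhs (1 : G) (U `&` V).
Proof. by move=> nU nV; apply: filterI. Qed.

Lemma nbhs1_sym_mul4 (G : topologicalGroupType) (V : set G) :
  nbhs (1 : G) V -> exists M : set G, [/\ nbhs (1 : G) M, M 1,
    forall x, M x -> M x^-1 &
    forall a b c d, M a -> M b -> M c -> M d -> V (a * b * c * d)].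
Proof.
move=> /nbhs1_split[W /nbhs1_split[M nM MW] WV].
have nM' := nbhs1I nM (nbhs1_inv nM).
exists (M `&` [set x | M x^-1]); split=> //.
  exact: (nbhs_singleton nM').
  by move=> x [Mx Mx'] /=; rewrite invgK.
move=> a b c d [Ma _] [Mb _] [Mc _] [Md _].
by rewrite -mulgA; apply: WV; exact: MW.
Qed.

Lemma nbhs1_conj (G : topologicalGroupType) (V : set G) :
  nbhs (1 : G) V -> exists M : set G, [/\ nbhs (1 : G) M, M 1,
    forall x, M x -> M x^-1, forall x y, M x -> M y -> V (x * y) &
    forall x y, M x -> M y -> V (x * y * x^-1)].
Proof.
move=> /nbhs1_sym_mul4[M [nM M1 MV M4]]; exists M; split=> // x y Mx My.
  by rewrite -[x * y]mulg1 -[x * y * 1]mulg1; exact: M4.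
by rewrite -[_ * x^-1]mulg1; apply: M4 => //; exact: MV.
Qed.

Definition neutral (G : topologicalGroupType) (A : set G) :=
  forall V, nbhs (1 : G) V -> exists2 U, nbhs (1 : G) U &
    forall u a, U u -> A a -> exists2 b, A b & V (b^-1 * (u * a)).

Definition equiconj (G : topologicalGroupType) (I : Type) (D : set I)
    (s : I -> G) :=
  forall V, nbhs (1 : G) V -> exists2 U, nbhs (1 : G) U &
    forall u i, U u -> D i -> V ((s i)^-1 * u * s i).

Definition left_separated (G : topologicalGroupType) (I : Type) (U : set G)
    (D : set I) (s : I -> G) :=
  forall i j, D i -> D j -> U ((s i)^-1 * s j) -> i = j.

Definition biseparated (G : topologicalGroupType) (I : Type) (U : set G)
    (D : set I) (s : I -> G) :=
  forall i j v w, D i -> D j -> U v -> U w -> v * s i = s j * w -> i = j.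

Lemma FSIN_neutral (R : realType) (G : topologicalGroupType) :
  FSIN R G -> forall A : set G, neutral A.
Proof.
move=> fsin A V nV; have [A0|nA0] := pselect (A !=set0); last first.
  exists setT; first exact: filterT.
  by move=> u a _ Aa; case: nA0; exists a.
have entE : @entourage (left_uniform G) [set xy | V (xy.1^-1 * xy.2)].
  by exists V.
have [f [bf /(fsin f bf) rf f0 [e e0 fe]]] :=
  @unif_continuous_separation R (left_uniform G) A _ entE A0.
have /rf[U nU UE] : @entourage R [set xy | ball xy.1 e xy.2].
  by rewrite -entourage_ballE; exists e.
exists U => // u a Uu Aa.
(* For the right uniformity [u * a] is close to [a], so [f (u * a)] is close to [f a = 0]. *)
have /UE /= : U ((u * a, a).1 * (u * a, a).2^-1) by rewrite /= mulgK.
rewrite /ball /= (f0 a Aa) subr0 => /ltr_normlW /fe[b Ab Vb].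
by exists b.
Qed.

(** A small left factor of [l i] can be moved to its right, where it stays small uniformly in
    [i]. *)
Lemma equiconj_biseparated (G : topologicalGroupType) (I : Type) (D : set I)
    (l : I -> G) (U : set G) :
  equiconj D l -> nbhs (1 : G) U -> left_separated U D l ->
  exists2 U1, nbhs (1 : G) U1 & biseparated U1 D l.
Proof.
move=> thin /nbhs1_conj[M [nM _ MV M2 _]] sep.
have [N nN lN] := thin M nM.
exists (M `&` N); first exact: nbhs1I.
move=> i j v w Di Dj [_ Nv] [Mw _] e; apply/esym/sep => //.
have -> : (l j)^-1 * l i = w * ((l i)^-1 * v * l i)^-1.
  by rewrite -mulgA e !invgM invgK !mulgA mulgV mul1g.
by apply: M2 => //; apply/MV/lN.
Qed.

(* The labels [l i] encode the relation [R] in the single set of all products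
   [t * l i] with [R t i], so that its neutrality makes [R] invariant. *)
Lemma label_transport (G : topologicalGroupType) (I : Type) (D : set I)
    (T : set G) (l : I -> G) (W V U1 N : set G) (R : G -> I -> Prop) :
  (forall A : set G, neutral A) ->
  nbhs (1 : G) V -> nbhs (1 : G) U1 -> nbhs (1 : G) N ->
  left_separated W T id ->
  (forall a b c d, V a -> V b -> V c -> V d -> W (a * b * c^-1 * d^-1)) ->
  (forall i, D i -> V (l i)) -> biseparated U1 D l ->
  exists2 U, nbhs (1 : G) U & forall u t, U u -> T t ->
    exists t', [/\ T t', N (t'^-1 * (u * t)) &
      forall i, D i -> R t i -> R t' i].
Proof.
move=> neu nV nU1 nN Tsep VW lV lsep.
have nVU := nbhs1I nV nU1.
have [U nU UT] := neu T _ (nbhs1I nN nVU).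
pose B := [set b : G | exists t i, [/\ T t, D i, R t i & b = t * l i]].
have [U' nU' UB] := neu B _ nVU.
exists (U `&` U'); first exact: nbhs1I.
move=> u t [Uu U'u] Tt; have [t' Tt' [Nt' [Vv Uv]]] := UT u t Uu Tt.
exists t'; split=> // i Di Rti.
have [|_ [t2 [j [Tt2 Dj Rt2 ->]]] [Vw Uw]] := UB u (t * l i) U'u.
  by exists t, i.
set v := t'^-1 * (u * t) in Vv Uv; set w := (t2 * l j)^-1 * _ in Vw Uw.
have e : t' * v * l i = t2 * l j * w by rewrite /v /w !mulVKg mulgA.
clearbody v w.
have t2E : t' = t2.
  apply: Tsep => //=.
  have -> : t'^-1 * t2 = v * l i * w^-1 * (l j)^-1.
    apply: (@mulgI _ t'); rewrite mulVKg !mulgA e.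
    by rewrite !mulgK.
  by apply: VW => //; exact: lV.
subst t2.
have e' : v * l i = l j * w by apply: (@mulgI _ t'); rewrite !mulgA.
by rewrite (lsep _ _ _ _ Di Dj Uv Uw e').
Qed.

(** Label a maximal separated subfamily of [t] by [l]. A small [u] moves [t j] close to a member
    with the same label, hence to [t j] itself, so its conjugate by [t j] is small. Every other
    [t i] is some [t j] up to a small right factor. *)
Lemma biseparated_small_equiconj (G : topologicalGroupType) (I : Type)
    (D : set I) (t : I -> G) :
  (forall A : set G, neutral A) -> ~ equiconj D t ->
  exists2 V, nbhs (1 : G) V & forall (l : I -> G) U1, nbhs (1 : G) U1 ->
    (forall i, D i -> V (l i)) -> ~ biseparated U1 D l.
Proof.
move=> neu /existsNP[V0 /not_implyP[nV0 nonthin]].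
have [M [nM M1 MV _ MC]] := nbhs1_conj nV0.
have [V [nV V1 VV VM]] := nbhs1_sym_mul4 nM.
exists V => // l U1 nU1 lV lsep; apply: nonthin.
have [||J [JD Jsep Jnet]] := @maximal_separated I D (fun i j => M ((t i)^-1 * t j)).
- by move=> i; rewrite mulVg.
- by move=> i j /MV; rewrite invgM invgK.
have sepM : left_separated M [set t i | i in J] id.
  by move=> _ _ [i Ji <-] [j Jj <-] /= ij; rewrite (Jsep i j).
have [|||U nU UJ] := @label_transport G I J _ l M V U1 M
    (fun g i => g = t i) neu nV nU1 nM sepM.
- by move=> a b c d Va Vb Vc Vd; apply: VM => //; exact: VV.
- by move=> i /JD /lV.
- by move=> i j v w /JD Di /JD Dj; exact: lsep.
exists U => // u i Uu Di; have [j Jj ji] := Jnet i Di.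
have [|_ [[k Jk <-] Mk /(_ j Jj erefl) tk]] := UJ u (t j) Uu; first by exists j.
rewrite tk in Mk.
have -> : (t i)^-1 * u * t i = ((t j)^-1 * t i)^-1 * ((t j)^-1 * (u * t j)) *
    ((t j)^-1 * t i)^-1^-1.
  by rewrite invgK invgM invgK !mulgA mulgK mulgK.
by apply: MC => //; exact: MV.
Qed.

(** * Small separated families, double cosets and minimal index sets *)

Ltac group_simp :=
  rewrite ?(invgM, invgK, invg1) ?mulgA ?(mulgK, mulgVK, mulVg, mulgV, mul1g, mulg1).

Lemma not_equiconjP (G : topologicalGroupType) (I : Type) (D : set I)
    (t : I -> G) : ~ equiconj D t ->
  exists2 V, nbhs (1 : G) V & forall U, nbhs (1 : G) U ->
    exists u i, [/\ U u, D i & ~ V ((t i)^-1 * u * t i)].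
Proof.
move=> /existsNP[V /not_implyP[nV nt]]; exists V => // U nU.
apply: contrapT => nu; apply: nt; exists U => // u i Uu Di.
by apply: contrapT => nVu; apply: nu; exists u, i.
Qed.

Lemma sub_equiconj (G : topologicalGroupType) (I : Type) (D D' : set I)
    (t : I -> G) : D `<=` D' -> equiconj D' t -> equiconj D t.
Proof.
move=> DD' thin V /thin[U nU UV]; exists U => // u i Uu /DD'.
exact: UV.
Qed.

(* Members of index [i] are chosen so small that conjugation by the earlier
   [tau j] and [u j * tau j] keeps them small, while conjugation by [tau i]
   does not; this puts the sets of all [tau i] and of all [u i * tau i] apart on
   the left, and neutrality of the first set then separates the [u i]. *)
Lemma small_separated_family (G : topologicalGroupType) (I : Type)
    (lt : I -> I -> Prop) (D : set I) (t : I -> G) (V : set G) :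
  (forall A : set G, neutral A) ->
  strict_total_order lt -> well_founded lt ->
  (forall x, D x -> forall s : I -> G, equiconj [set y | D y /\ lt y x] s) ->
  ~ equiconj D t -> nbhs (1 : G) V ->
  exists (l : I -> G) U,
    [/\ nbhs (1 : G) U, forall i, D i -> V (l i) & left_separated U D l].
Proof.
move=> neu [_ _ tot] wf init /not_equiconjP[V0 nV0 tV0] nV.
have [P [nP P1 PV P2 PC]] := nbhs1_conj nV0.
have [M [nM M1 MV M2 _]] := nbhs1_conj nP.
have MP x : M x -> P x by move=> Mx; rewrite -[x]mulg1; exact: M2.
pose C (_ : I) (y : G * G) :=
  V y.1^-1 /\ ~ V0 (y.2^-1 * y.1 * y.2).
pose Q (y' y : G * G) := M (y'.2^-1 * y.1 * y'.2) /\
  M ((y'.1 * y'.2)^-1 * y.1 * (y'.1 * y'.2)).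
have step x : D x -> forall h : I -> G * G, exists2 y, C x y &
    forall a, D a -> lt a x -> Q (h a) y.
  move=> Dx h.
  have [N1 nN1 hN1] := init x Dx (fun a => (h a).2) M nM.
  have [N2 nN2 hN2] := init x Dx (fun a => (h a).1 * (h a).2) M nM.
  have [u [i [[[N1u N2u] Vu] Di nVu]]] :=
    tV0 _ (nbhs1I (nbhs1I nN1 nN2) (nbhs1_inv nV)).
  exists (u, t i) => //=.
  by move=> a Da ax; split; [exact: hN1|exact: hN2].
have [F FP] := transfinite_choice (1, 1) wf step.
pose u i := (F i).1; pose tau i := (F i).2.
have Vu i : D i -> V (u i)^-1 by move=> /FP[[]].
have nVtau i : D i -> ~ V0 ((tau i)^-1 * u i * tau i) by move=> /FP[[]].
have Mtau i j : D i -> D j -> lt i j -> M ((tau i)^-1 * u j * tau i).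
  by move=> Di /FP[_ /(_ i Di)] /[apply] -[].
have Mutau i j : D i -> D j -> lt i j ->
    M ((u i * tau i)^-1 * u j * (u i * tau i)).
  by move=> Di /FP[_ /(_ i Di)] /[apply] -[].
(* If [z] were small, conjugation by it or its inverse would make the [tau]-conjugate of the later
   [u] small, against [nVtau]. *)
have far i j : D i -> D j -> ~ P ((tau j)^-1 * (u i * tau i)).
  move=> Di Dj; set z := _ * _ => Pz.
  have [ij|/tot[ij|ji]] := pselect (i = j).
  - subst j; apply: (nVtau i) => //.
    have -> : (tau i)^-1 * u i * tau i = z * 1 by rewrite /z; group_simp.
    exact: P2.
  - apply: (nVtau j) => //.
    have := PC _ _ Pz (MP _ (Mutau i j Di Dj ij)).
    by rewrite /z; group_simp.
  - apply: (nVtau i) => //.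
    have := PC _ _ (PV _ Pz) (MP _ (Mtau j i Dj Di ji)).
    by rewrite /z; group_simp.
have [U nU UB] := neu [set tau i | i in D] M nM.
have sep i j : D i -> D j -> lt i j -> ~ U (u i * (u j)^-1).
  move=> Di Dj ij Uij.
  have [|_ [k Dk <-] Mk] := UB _ (tau i) Uij; first by exists i.
  apply: (far i k Di Dk).
  have := M2 _ _ Mk (Mtau i j Di Dj ij).
  by group_simp.
exists (fun i => (u i)^-1), (U `&` [set x | U x^-1]); split => //.
  exact: nbhs1I nU (nbhs1_inv nU).
move=> i j Di Dj /=; rewrite invgK => -[Uij Uji].
apply: contrapT => /tot[ij|ji]; first exact: sep Uij.
by move: Uji; rewrite invgM invgK; exact: sep.
Qed.

(** Otherwise each term could be chosen in [V] outside the double cosets of all earlier terms, which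
    yields a biseparated family. *)
Lemma double_coset_cover (G : topologicalGroupType) (I : Type)
    (lt : I -> I -> Prop) (D : set I) (V M : set G) :
  strict_total_order lt -> well_founded lt ->
  nbhs (1 : G) M -> (forall x, M x -> M x^-1) ->
  (forall l : I -> G, (forall i, D i -> V (l i)) -> ~ biseparated M D l) ->
  exists x (h : I -> G), D x /\ forall y, V y -> exists a m m',
    [/\ D a, lt a x, M m, M m' & y = m * h a * m'].
Proof.
move=> [_ _ tot] wf nM MV nsep; apply: contrapT => ncov.
pose Q (f y : G) := forall m m', M m -> M m' -> y <> m * f * m'.
have step x : D x -> forall h : I -> G, exists2 y, V y &
    forall a, D a -> lt a x -> Q (h a) y.
  move=> Dx h; apply: contrapT => ny; apply: ncov; exists x, h.
  split=> // y Vy; apply: contrapT => na; apply: ny; exists y => //.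
  by move=> a Da ax m m' Mm Mm' ye; apply: na; exists a, m, m'.
have [F FP] := transfinite_choice (C := fun=> V) 1 wf step.
apply: (nsep F); first by move=> i /FP[].
move=> i j v w Di Dj Mv Mw e; apply: contrapT => /tot[ij|ji].
- apply: (((FP j Dj).2 i Di ij) v w^-1) => //; first exact: MV.
  by rewrite e mulgK.
- apply: (((FP i Di).2 j Dj ji) v^-1 w) => //; first exact: MV.
  by rewrite -mulgA -e mulKg.
Qed.

Lemma minimal_non_equiconj (G : topologicalGroupType) :
  ~ equiconj [set: G] id -> exists (lt : G -> G -> Prop) D (t : G -> G),
    [/\ strict_total_order lt, well_founded lt, ~ equiconj D t &
     forall x, D x -> forall s : G -> G, equiconj [set y | D y /\ lt y x] s].
Proof.
move=> nid; have [lt [sto wf]] := well_order_exists G.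
pose bad x := exists s : G -> G, ~ equiconj [set y | lt y x] s.
have [[x badx]|nbad] := pselect (exists x, bad x); last first.
  exists lt, setT, id; split=> // x _ s; apply: contrapT => ns.
  apply: nbad; exists x, s; apply: contra_not ns.
  by apply: sub_equiconj => y [].
elim/(well_founded_ind wf): x badx => x IH [t nt].
have [[y yx bady]|nbad] := pselect (exists2 y, lt y x & bad y).
  exact: IH bady.
exists lt, [set y | lt y x], t; split=> // y yx s; apply: contrapT => ns.
apply: nbad; exists y => //; exists s; apply: contra_not ns.
by apply: sub_equiconj => z [].
Qed.

(** * Powers of small elements and the finite exponent *)

Lemma nbhs1_expg (G : topologicalGroupType) (V : set G) (n : nat) :
  nbhs (1 : G) V -> nbhs (1 : G) [set u | V (u ^+ n)].
Proof.
elim: n V => [|n IH] V nV.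
  apply: filterS filterT => u _ /=; rewrite expg0.
  exact: (nbhs_singleton nV).
have [W nW WV] := nbhs1_split nV.
by apply: filterS (nbhs1I nW (IH W nW)) => u [Wu Wun] /=; rewrite expgS; exact: WV.
Qed.

Lemma nbhs1_expg_le (G : topologicalGroupType) (V : set G) (n : nat) :
  nbhs (1 : G) V -> exists2 U, nbhs (1 : G) U &
    forall u k, U u -> (k <= n)%N -> V (u ^+ k).
Proof.
move=> nV; elim: n => [|n [U nU UV]].
  exists [set u | V (u ^+ 0)]; first exact: nbhs1_expg.
  by move=> u k Vu; rewrite leqn0 => /eqP ->.
exists (U `&` [set u | V (u ^+ n.+1)]); first exact: nbhs1I nU (nbhs1_expg _ nV).
move=> u k [Uu Vu]; rewrite leq_eqVlt ltnS => /orP[/eqP -> //|].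
exact: UV.
Qed.

(* If [u] is small and [s^-1 * u * s] lies in [V1], then [u] carries the point
   [s] of a maximal [E]-separated set [S] to a point [s1] of [S]. The order
   relation between [s] and [s1] is recorded by a relation on [T * I] that the
   powers of [u] preserve, so [u] moves [s] monotonically along a cycle, whence
   [s1 = s]. *)
Lemma equiconj_dichotomy (G : topologicalGroupType) (I : Type)
    (lt : I -> I -> Prop) (D : set I) (t : I -> G) (V1 : set G) (p : nat) :
  (forall A : set G, neutral A) -> (1 <= p)%N -> (forall x : G, x ^+ p = 1) ->
  strict_total_order lt -> well_founded lt ->
  (forall x, D x -> forall s : I -> G, equiconj [set y | D y /\ lt y x] s) ->
  ~ equiconj D t -> nbhs (1 : G) V1 ->
  (forall (l : I -> G) U, nbhs (1 : G) U -> (forall i, D i -> V1 (l i)) ->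
    ~ biseparated U D l) ->
  exists2 V', nbhs (1 : G) V' & forall V, nbhs (1 : G) V ->
    exists2 U, nbhs (1 : G) U & forall u g, U u ->
      V' (g^-1 * u * g) -> V (g^-1 * u * g).
Proof.
move=> neu p1 Gp sto wf init nt nV1 nlabel.
have [V' [nV' _ V'V _ V'C]] := nbhs1_conj nV1.
exists V' => // V nV.
have [E0 [nE0 _ E0V _ E0C]] := nbhs1_conj nV.
(* [E0] serves to conjugate from [E] back into [V]; [V'] keeps the conjugates inside [V1], which the
   double cosets cover. *)
pose E := E0 `&` V'.
have nE : nbhs 1 E by exact: nbhs1I.
have EV x : E x -> E x^-1 by move=> [/E0V ? /V'V ?].
have [E1 [nE1 E11 E1V E14]] := nbhs1_sym_mul4 nE.
have E1E x y : E1 x -> E1 y -> E (x * y^-1).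
  by move=> /E14 h /E1V /h /(_ E11 E11); rewrite !mulg1.
have [M [nM M1 MV M4]] := nbhs1_sym_mul4 nE1.
have ME x : M x -> E x.
  move=> Mx; have /E1E /(_ E11) := M4 _ _ _ _ Mx M1 M1 M1.
  by rewrite invg1 !mulg1.
have [S [_ Ssep Snet]] :=
  @maximal_separated G setT (fun x y => E (x^-1 * y))
    ltac:(by move=> x /=; rewrite mulVg; exact: (nbhs_singleton nE))
    ltac:(by move=> x y /EV /=; rewrite invgM invgK).
have [x [h [Dx cov]]] := double_coset_cover sto wf nM MV
  (fun l => nlabel l M nM).
pose D' := [set a | D a /\ lt a x].
have [W0 nW0 hW0] := init x Dx h M nM.
pose W1 := M `&` W0; pose W := W1 `&` [set w | W1 w^-1].
have nW : nbhs 1 W by have nW1 := nbhs1I nM nW0; exact: nbhs1I nW1 (nbhs1_inv nW1).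
have WV w : W w -> W w^-1 by move=> [Ww Ww']; split=> //=; rewrite invgK.
have WM w : W w -> M w by case=> -[].
have hW w a : W w -> D' a -> M ((h a)^-1 * w * h a).
  by move=> [[_ Ww] _]; exact: hW0.
have [T [_ Tsep Tnet]] :=
  @maximal_separated G setT (fun x y => W (x^-1 * y))
    ltac:(by move=> y /=; rewrite mulVg; exact: (nbhs_singleton nW))
    ltac:(by move=> y z /WV /=; rewrite invgM invgK).
have [VL [nVL _ VLV VL4]] := nbhs1_sym_mul4 nW.
have [l [U0 [nU0 lVL lsep]]] := small_separated_family neu sto wf init nt nVL.
have [U1 nU1 {}lsep] : exists2 U1, nbhs (1 : G) U1 & biseparated U1 D' l.
  apply: equiconj_biseparated (init x Dx l) nU0 _.
  by move=> i j [Di _] [Dj _]; exact: lsep.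
have {}lVL i : D' i -> VL (l i) by move=> [/lVL].
have {}VL4 a b c d : VL a -> VL b -> VL c -> VL d -> W (a * b * c^-1 * d^-1).
  by move=> ? ? /VLV ? /VLV ?; exact: VL4.
(* A point of [S] that is [E1]-close to a given element is unique, so [R r] compares the
   discretizations of [g] and [g * h i]. *)
pose R (r : G -> G -> Prop) g i := exists s s',
  [/\ S s, S s', E1 (s^-1 * g), E1 (s'^-1 * (g * h i)) & r s s'].
have transport r := label_transport (R r) neu nVL nU1 nW Tsep VL4 lVL lsep.
have [ltG [[irr tr tot] _]] := well_order_exists G.
have [U2 nU2 U2R] := transport ltG.
have [U3 nU3 U3R] := transport (fun y z => ltG z y).
have [US nUS USS] := neu S M nM.
have [U nU Upow] := nbhs1_expg_le p (nbhs1I (nbhs1I nU2 nU3) nUS).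
exists U => // u g Uu V'u.
have [s Ss sg] := Snet g Logic.I.
pose w := s^-1 * g; rewrite -/w in sg.
have suE : s^-1 * u * s = w * (g^-1 * u * g) * w^-1 by rewrite /w; group_simp.
suff Es : E (s^-1 * u * s).
  have -> : g^-1 * u * g = w^-1 * (s^-1 * u * s) * w^-1^-1.
    by rewrite suE; group_simp.
  by apply: E0C; [apply: E0V; exact: sg.1|exact: Es.1].
have [a [m [m' [Da ax Mm Mm' sue]]]] : exists a m m',
    [/\ D a, lt a x, M m, M m' & s^-1 * u * s = m * h a * m'].
  by apply: cov; rewrite suE; apply: V'C => //; exact: sg.2.
(* [t0] is close to [s] and [t0 * h a] to [u * s], so the pair of [t0] and [a] encodes the move of
   [s] by [u]. *)
have [t0 Tt0 Wc] := Tnet (s * m) Logic.I.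
set c := _^-1 * _ in Wc.
have t0E : t0 = s * m * c^-1 by rewrite /c; group_simp.
have usE : u * s = s * m * h a * m'.
  by apply: (@mulgI _ s^-1); rewrite !mulgA sue; group_simp.
have Da' : D' a by [].
clearbody c.
(* [sg_ k] is the point of [S] near [u ^+ k * s], with a junk value beyond [p]. *)
have /choice[sg_ sgP] : forall k, exists sk, (k <= p)%N ->
    S sk /\ M (sk^-1 * (u ^+ k * s)).
  move=> k; have [kp|] := leqP k p; last by exists 1.
  have [sk Ssk Msk] := USS _ _ (Upow u k Uu kp).2 Ss.
  by exists sk.
have s0 : sg_ 0%N = s.
  have [S0 M0] := sgP 0%N (leq0n p).
  by apply: Ssep => //; apply: ME; rewrite expg0 mul1g in M0.
have sp : sg_ p = s.
  have [Sp Mp] := sgP p (leqnn p).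
  by apply: Ssep => //; apply: ME; rewrite Gp mul1g in Mp.
(* Transporting the relation at [t0] by [u ^+ k] gives a point [tk] such that [tk] and [tk * h a]
   discretize to [sg_ k] and [sg_ k.+1]. *)
have R_step r Ur : (forall v t, Ur v -> T t -> exists t',
      [/\ T t', W (t'^-1 * (v * t)) & forall i, D' i -> R r t i -> R r t' i]) ->
    (forall k, (k <= p)%N -> Ur (u ^+ k)) -> r s (sg_ 1%N) ->
    forall k, (k < p)%N -> r (sg_ k) (sg_ k.+1).
  move=> UrR Uru rs1 k kp.
  have R0 : R r t0 a.
    have [S1 Ms1] := sgP 1%N p1.
    exists s, (sg_ 1%N); split=> //.
    - have := M4 _ _ _ _ Mm (WM _ (WV _ Wc)) M1 M1.
      by rewrite t0E; group_simp.
    - have := M4 _ _ _ _ Ms1 (MV _ Mm') (hW _ _ (WV _ Wc) Da') M1.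
      by rewrite expg1 usE t0E; group_simp.
  have [tk [Ttk Wn /(_ a Da' R0)[b [b' [Sb Sb' Eb Eb' rbb]]]]] :=
    UrR (u ^+ k) t0 (Uru k (ltnW kp)) Tt0.
  set n := _^-1 * _ in Wn.
  have tkE : tk = u ^+ k * t0 * n^-1 by rewrite /n; group_simp.
  have [Sk Mk] := sgP k (ltnW kp); have [Sk1 Mk1] := sgP k.+1 kp.
  clearbody n.
  have bE : b = sg_ k.
    apply: Ssep => //.
    have Ek : E1 ((sg_ k)^-1 * tk).
      have := M4 _ _ _ _ Mk Mm (WM _ (WV _ Wc)) (WM _ (WV _ Wn)).
      by rewrite tkE t0E; group_simp.
    by have := E1E _ _ Eb Ek; group_simp.
  have bE' : b' = sg_ k.+1.
    apply: Ssep => //.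
    have Ek : E1 ((sg_ k.+1)^-1 * (tk * h a)).
      have := M4 _ _ _ _ Mk1 (MV _ Mm') (hW _ _ (WV _ Wc) Da')
        (hW _ _ (WV _ Wn) Da').
      by rewrite expgSr -(mulgA _ u s) usE tkE t0E; group_simp.
    by have := E1E _ _ Eb' Ek; group_simp.
  by rewrite -bE -bE'.
have cycle r : (forall y z v, r y z -> r z v -> r y v) ->
    (forall k, (k < p)%N -> r (sg_ k) (sg_ k.+1)) -> r s s.
  move=> rtr rstep; rewrite -{2}sp -s0.
  have : forall k, (k < p)%N -> r (sg_ 0%N) (sg_ k.+1).
    elim=> [|k IH] kp; first exact: rstep.
    exact: rtr (IH (ltnW kp)) (rstep _ kp).
  by move=> /(_ p.-1); rewrite prednK//; apply.
have [s1|/tot[lts|lts]] := pselect (s = sg_ 1%N).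
- have [_] := sgP 1%N p1.
  by rewrite -s1 expg1 mulgA; exact: ME.
- exfalso; apply: (irr s); apply: (cycle ltG) => //.
  by apply: R_step U2R _ lts => k kp; exact: (Upow u k Uu kp).1.1.
- exfalso; apply: (irr s); apply: (cycle (fun y z => ltG z y)).
    by move=> y z v yz zv; exact: tr zv yz.
  by apply: R_step U3R _ lts => k kp; exact: (Upow u k Uu kp).1.2.
Qed.

(** * From uniformly small conjugates to SIN *)

Lemma equiconj_SIN (G : topologicalGroupType) : equiconj [set: G] id -> SIN G.
Proof.
move=> thin; apply/seteqP; split=> A [V nV VA].
- have [U nU UV] := thin V nV.
  exists [set z | U z^-1]; first exact: nbhs1_inv.
  move=> [x y] /= Uxy; apply: VA => /=.
  (* [x^-1 * y] is the conjugate of [y * x^-1] by [x]. *)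
  by have := UV _ x Uxy Logic.I; group_simp.
- have [U nU UV] := thin V nV.
  exists [set z | U z^-1]; first exact: nbhs1_inv.
  move=> [x y] /= Uxy; apply: VA => /=.
  by have := UV _ x^-1 Uxy Logic.I; group_simp.
Qed.

Theorem corollary3p7 (R : realType) (G : topologicalGroupType)
  (G_hausdorff : hausdorff_space G) (G_fsin : FSIN R G)
  (G_exponent : finite_exponent G) : SIN G.
Proof.
have neu := FSIN_neutral G_fsin; have [p p1 Gp] := G_exponent.
apply: equiconj_SIN; apply: contrapT => /minimal_non_equiconj.
move=> [lt [D [t [sto wf nt init]]]].
have [V1 nV1 nlabel] := biseparated_small_equiconj neu nt.
have [V' nV' V'V] := equiconj_dichotomy neu p1 Gp sto wf init nt nV1 nlabel.
have [V2 [nV2 V21 V2V V2M V2C]] := nbhs1_conj (nbhs1I nV1 nV').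
have V2V1 x : V2 x -> V1 x by move=> /V2M /(_ V21)[+ _]; rewrite mulg1.
have [l [U [nU lV2 lsep]]] := small_separated_family neu sto wf init nt nV2.
have [/equiconj_biseparated /(_ nU lsep)[U1 nU1]|] := pselect (equiconj D l).
  by apply: (nlabel l U1 nU1) => i /lV2; exact: V2V1.
(* For [u] and [l i] in [V2], the conjugate of [u] by [l i] lies in [V'], hence in [V] once [u] is
   in [N]. *)
move=> /not_equiconjP[V nV lV]; have [N nN NV] := V'V V nV.
have [u [i [[Nu V2u] Di]]] := lV _ (nbhs1I nN nV2).
apply; apply: NV => //; rewrite -[X in _ * X]invgK.
by apply: (V2C _ _ (V2V _ (lV2 i Di)) V2u).2.
Qed.
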